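(* Let $\Lambda$ be a finite set, and let $0=H_0\le H_1\le\cdots\le H_N$ be an increasing sequence of non-negative self-adjoint elements $H_n\in\mathcal{A}_\Lambda^+$, $0\le n\le N$, acting on the fermionic Fock space $\mathcal{H}_\Lambda$ and each having non-trivial kernel. Let $h_n=H_n-H_{n-1}$ for $n=1,\dots,N$, let $G_n$ and $g_n$ be the orthogonal projections onto $\ker H_n$ and $\ker h_n$, respectively, and let $$E_0=\mathbb{1}-G_1,\qquad E_n=G_n-G_{n+1}\ (1\le n\le N-1),\qquad E_N=G_N.$$ Suppose that: (i) there is a constant $\gamma>0$ such that $h_n\ge\gamma(\mathbb{1}-g_n)$ for $1\le n\le N$; (ii) there is an integer $\ell\ge0$ such that whenever $0\le n\le N-1$ and $k\notin[n-\ell,n]$, $[E_k,g_{n+1}]=0$; (iii) there exists a positive $\epsilon<1/\sqrt{\ell+1}$ such that $E_ng_{n+1}E_n\le\epsilon^2E_n$ for $0\le n\le N-1$. If $\psi\in\mathcal{H}_\Lambda$ is such that $G_N\psi=0$, then $$\langle\psi,H_N\psi\rangle\ge\gamma\,(1-\epsilon\sqrt{1+\ell})^2\,\|\psi\|^2.$$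
   Context: $\mathcal{A}_\Lambda$ is the CAR algebra over the finite set $\Lambda$, generated by $a_x,a_x^*$, $x\in\Lambda$, with $\{a_x,a_y\}=\{a_x^*,a_y^*\}=0$, $\{a_x,a_y^*\}=\delta_{x,y}\mathbb{1}$, where $\{A,B\}=AB+BA$; it is represented as the algebra of all bounded operators on the (finite-dimensional) antisymmetric Fock space $\mathcal{H}_\Lambda$ generated by $\ell^2(\Lambda)$. $\mathcal{A}_\Lambda^+$ is the set of even elements: those $A\in\mathcal{A}_\Lambda$ with $(-1)^{N_\Lambda}A(-1)^{N_\Lambda}=A$, where $N_\Lambda=\sum_{x\in\Lambda}a_x^*a_x$. $[A,B]=AB-BA$. In assumption (ii), $k$ ranges over $\{0,1,\dots,N\}$. *)

(* Defs.v *)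
From HB Require Import structures.
From mathcomp Require Import all_boot all_order all_algebra.
From mathcomp Require Import complex reals ring.

Set Implicit Arguments.
Unset Strict Implicit.
Unset Printing Implicit Defensive.
Import Order.TTheory GRing.Theory Num.Theory.
Local Open Scope ring_scope.
Local Open Scope sesquilinear_scope.

(* The antisymmetric Fock space over l^2(L) is written in its orthonormal
   basis  ket X = e_{x_1} /\ ... /\ e_{x_n},  where X = {x_1, ..., x_n} runs
   over all subsets of L and its elements are listed in the order of enum L.
   Vectors are columns and operators are square matrices acting on the left. *)
Notation fdim L := #|{: {set L}}|.
Notation fock R L := 'cV[R[i]]_(fdim L).
Notation fock_op R L := 'M[R[i]]_(fdim L).

Section Hilbert.
Variables (R : realType) (d : nat).
Implicit Types (psi phi : 'cV[R[i]]_d) (A B P : 'M[R[i]]_d).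

(* Conjugate-linear in the first argument. *)
Definition inner psi phi : R[i] := (psi^t* *m phi) 0 0.

(* The order of R[i] compares only numbers with equal imaginary parts, so this
   says that <psi, (B - A) psi> is real and non-negative for all psi. *)
Definition le_op A B : Prop :=
  forall psi, inner psi (A *m psi) <= inner psi (B *m psi).

Definition comm_op A B := A *m B - B *m A.

Definition nontrivial_ker A : Prop := exists2 psi : 'cV[R[i]]_d, psi != 0 & A *m psi = 0.

Definition is_ker_proj A P : Prop :=
  [/\ P \is hermsymmx, P *m P = P
    & forall psi, P *m psi = psi <-> A *m psi = 0].

(* h_n = H_n - H_{n-1}, meant for n >= 1. *)
Definition increment (H : nat -> 'M[R[i]]_d) (n : nat) := H n - H n.-1.

(* E_0, ..., E_N.  The test n == N comes first, so for N = 0 the single layer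
   is E_0 = G_0; for N >= 1 the order of the tests is immaterial. *)
Definition layer (N : nat) (G : nat -> 'M[R[i]]_d) (n : nat) :=
  if n == N then G N
  else if n == 0%N then 1%:M - G 1%N
  else G n - G n.+1.

Lemma hermsymP A : A \is hermsymmx <-> A^t* = A.
Proof.
split; first by move/is_hermitianmxP; rewrite expr0 scale1r => /esym.
by move=> h; apply/is_hermitianmxP; rewrite expr0 scale1r h.
Qed.

Lemma mx_eq_on_vectors A B : (forall psi, A *m psi = B *m psi) -> A = B.
Proof.
move=> AB; apply/matrixP => i j.
by have /matrixP/(_ i 0) := AB (delta_mx j 0); rewrite -!colE !mxE.
Qed.

Lemma is_ker_proj_unique A P Q : is_ker_proj A P -> is_ker_proj A Q -> P = Q.
Proof.
move=> [/hermsymP Ph PP PA] [/hermsymP Qh QQ QA].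
have PQ : P *m Q = Q.
  by apply: mx_eq_on_vectors => v; rewrite -mulmxA; apply/PA/QA; rewrite mulmxA QQ.
have QP : Q *m P = P.
  by apply: mx_eq_on_vectors => v; rewrite -mulmxA; apply/QA/PA; rewrite mulmxA PP.
by rewrite -Qh -PQ trmx_mul map_mxM /= Ph Qh QP.
Qed.

Lemma is_ker_proj_exists A : exists P, is_ker_proj A P.
Proof.
pose K := kermx A^T; pose Q := proj_ortho K.
have Qh : Q^t* = Q.
  have : Q *m (1%:M - Q)^t* = 0.
    rewrite -[Q in LHS]mul1mx.
    apply/orthomx1P/(submx_trans (proj_ortho_sub _ _)).
    rewrite orthomx_sym.
    by have := proj_ortho_compl_sub K 1%:M; rewrite mul1mx.
  rewrite linearB /= map_mxB trmx1 map_mx1 mulmxBr mulmx1.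
  move/subr0_eq => QQ; rewrite [in LHS]QQ.
  by rewrite trmx_mul map_mxM /= trmxCK -QQ.
exists Q^T; split.
- by apply/hermsymP; rewrite trmxK -[in RHS]Qh map_trmx trmxK.
- by rewrite -trmx_mul proj_ortho_proj.
move=> v; split=> h.
  apply: trmx_inj; rewrite trmx_mul trmx0; apply/sub_kermxP.
  by rewrite -h trmx_mul trmxK proj_ortho_sub.
apply: trmx_inj; rewrite trmx_mul trmxK proj_ortho_id //.
by apply/sub_kermxP; rewrite -trmx_mul h trmx0.
Qed.

End Hilbert.

Section CAR.
Variables (R : realType) (L : finType).
Local Notation C := R[i].
Implicit Types (x y : L) (X Y : {set L}) (A B : fock_op R L).

Definition occ (i : 'I_(fdim L)) : {set L} := enum_val i.

Definition ket X : fock R L := delta_mx (enum_rank X) 0.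

(* The sign produced by moving e_x past the elements of X preceding it. *)
Definition fsign x X : C :=
  (-1) ^+ #|[set y in X | (enum_rank y < enum_rank x)%N]|.

Definition ann x : fock_op R L := \matrix_(i, j)
  if (x \in occ j) && (occ i == occ j :\ x) then fsign x (occ j) else 0.

Definition cre x : fock_op R L := (ann x)^t*.

Definition num_op : fock_op R L := \sum_(x : L) cre x *m ann x.

(* (-1)^N : the number operator is diagonal with N (ket X) = #|X| ket X, see
   num_op_ket below. *)
Definition parity : fock_op R L := \matrix_(i, j)
  if i == j then (-1) ^+ #|occ j| else 0.

Inductive car_algebra : fock_op R L -> Prop :=
| CarAnn x : car_algebra (ann x)
| CarCre x : car_algebra (cre x)
| CarOne : car_algebra 1%:M
| CarAdd A B : car_algebra A -> car_algebra B -> car_algebra (A + B)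
| CarScale (c : C) A : car_algebra A -> car_algebra (c *: A)
| CarMul A B : car_algebra A -> car_algebra B -> car_algebra (A *m B).

Definition even_op A : Prop := car_algebra A /\ parity *m A *m parity = A.

Lemma eq_on_kets A B : (forall X, A *m ket X = B *m ket X) -> A = B.
Proof.
move=> AB; apply/matrixP => i j.
have /matrixP/(_ i 0) := AB (enum_val j).
by rewrite /ket enum_valK -!colE !mxE.
Qed.

Lemma ann_ket x Y :
  ann x *m ket Y = if x \in Y then fsign x Y *: ket (Y :\ x) else 0.
Proof.
apply/matrixP => i j; rewrite ord1 /ket -colE !mxE /occ enum_rankK.
case xY: (x \in Y) => /=; rewrite !mxE // eqxx andbT.
by rewrite -(inj_eq enum_val_inj) enum_rankK; case: eqP; rewrite ?mulr1 ?mulr0.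
Qed.

Lemma fsignD1 x y Y : y \in Y ->
  fsign x Y = (-1) ^+ (enum_rank y < enum_rank x)%N * fsign x (Y :\ y).
Proof.
move=> yY; rewrite /fsign -exprD (cardsD1 y) inE yY /=.
congr (_ ^+ (_ + _)); apply: eq_card => z; rewrite !inE.
by case: (z == y).
Qed.

Lemma fsign_conj x Y : (fsign x Y)^* = fsign x Y.
Proof. by rewrite /fsign rmorphXn rmorphN rmorph1. Qed.

Lemma fsign_sq x Y : fsign x Y * fsign x Y = 1.
Proof. by rewrite /fsign -expr2 sqrr_sign. Qed.

Lemma cre_ket x Y :
  cre x *m ket Y = if x \in Y then 0 else fsign x Y *: ket (x |: Y).
Proof.
apply/matrixP => i j; rewrite ord1 /ket -colE !mxE /occ enum_rankK.
case xY: (x \in Y) => /=; rewrite !mxE.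
  case: ifP => [/andP[xi /eqP E]|_]; last by rewrite conjC0.
  by move: xY; rewrite E !inE eqxx.
rewrite eqxx andbT -(inj_eq enum_val_inj) enum_rankK.
case: ifP => [/andP[xi /eqP E]|E].
  have -> : x |: Y = enum_val i by rewrite E setD1K.
  rewrite eqxx mulr1 fsign_conj (fsignD1 x xi) ltnn expr0 mul1r.
  by rewrite -E.
case: eqP => [Ei|_]; last by rewrite conjC0 mulr0.
by move: E; rewrite Ei !inE eqxx /= setU1K ?xY // eqxx.
Qed.

Lemma car_ann_ann x y : ann x *m ann y + ann y *m ann x = 0.
Proof.
apply: eq_on_kets => Y; rewrite mulmxDl -!mulmxA !ann_ket mul0mx.
case xY: (x \in Y); case yY: (y \in Y); rewrite ?mulmx0 -?scalemxAr ?ann_ket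
  ?inE ?xY ?yY ?andbT ?andbF ?scaler0 ?addr0 //.
case: eqVneq => [->|nxy] /=; first by rewrite scaler0 addr0.
rewrite !scalerA (fsignD1 x yY) (fsignD1 y xY) !setDDl setUC -scalerDl.
set a := fsign x _; set b := fsign y _.
suff -> : (-1) ^+ (enum_rank x < enum_rank y)%N =
  - (-1) ^+ (enum_rank y < enum_rank x)%N :> C.
  by rewrite (_ : _ + _ = 0) ?scale0r //; ring.
case: ltngtP; rewrite ?expr1 ?opprK // => /val_inj /enum_rank_inj E.
by rewrite E eqxx in nxy.
Qed.

Lemma adjM A B : (A *m B)^t* = B^t* *m A^t*.
Proof. by rewrite trmx_mul map_mxM. Qed.

Lemma car_cre_cre x y : cre x *m cre y + cre y *m cre x = 0.
Proof.
rewrite /cre -!adjM -map_mxD -linearD /= addrC car_ann_ann.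
by rewrite trmx0 map_mx0.
Qed.

Lemma car_ann_cre x y :
  ann x *m cre y + cre y *m ann x = if x == y then 1%:M else 0.
Proof.
apply: eq_on_kets => Y; rewrite mulmxDl -!mulmxA !ann_ket cre_ket.
case: (eqVneq x y) => [<-|nxy].
  rewrite mul1mx; case xY: (x \in Y).
    rewrite mulmx0 add0r -scalemxAr cre_ket !inE eqxx /= setD1K //.
    by rewrite (fsignD1 x xY) ltnn mul1r scalerA fsign_sq scale1r.
  rewrite mulmx0 addr0 -scalemxAr ann_ket setU11 setU1K ?xY //.
  by rewrite (fsignD1 x (setU11 x Y)) ltnn mul1r setU1K ?xY // scalerA fsign_sq scale1r.
rewrite mul0mx.
have nyx : (y == x) = false by rewrite eq_sym (negbTE nxy).
case xY: (x \in Y); case yY: (y \in Y); rewrite ?mulmx0 -?scalemxAr ?ann_ket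
  ?cre_ket ?inE ?xY ?yY ?(negbTE nxy) ?nyx /= ?scaler0 ?addr0 //.
have -> : (y |: Y) :\ x = y |: (Y :\ x).
  by apply/setP => z; rewrite !inE; case: (eqVneq z y) => [->|//]; rewrite nyx.
rewrite !scalerA -scalerDl (fsignD1 x (setU11 y Y)) setU1K ?yY //.
rewrite (fsignD1 y xY).
set a := fsign x _; set b := fsign y _.
suff -> : (-1) ^+ (enum_rank x < enum_rank y)%N =
  - (-1) ^+ (enum_rank y < enum_rank x)%N :> C.
  set s := (-1) ^+ _; have ss : s * s = 1 by rewrite -expr2 sqrr_sign.
  rewrite (_ : _ + _ = (1 - s * s) * (a * b)); last by ring.
  by rewrite ss subrr mul0r scale0r.
case: ltngtP; rewrite ?expr1 ?opprK // => /val_inj /enum_rank_inj E.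
by rewrite E eqxx in nxy.
Qed.

Lemma num_op_ket Y : num_op *m ket Y = #|Y|%:R *: ket Y.
Proof.
rewrite /num_op mulmx_suml (bigID (mem Y)) /= addrC big1 => [|x xY]; last first.
  by rewrite -mulmxA ann_ket (negbTE xY) mulmx0.
rewrite add0r (eq_bigr (fun=> ket Y)) => [|x xY].
  by rewrite sumr_const scaler_nat.
rewrite -mulmxA ann_ket xY -scalemxAr cre_ket !inE eqxx /= setD1K //.
by rewrite (fsignD1 x xY) ltnn mul1r scalerA fsign_sq scale1r.
Qed.

Lemma parity_ket Y : parity *m ket Y = (-1) ^+ #|Y| *: ket Y.
Proof.
apply/matrixP => i j; rewrite ord1 /ket -colE !mxE /occ enum_rankK eqxx andbT.
by case: eqP; rewrite ?mulr1 ?mulr0.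
Qed.

Lemma car_algebra0 : car_algebra 0.
Proof. by rewrite -(scale0r 1%:M); apply/CarScale/CarOne. Qed.

Lemma ann_cre_ket x Y :
  ann x *m cre x *m ket Y = if x \in Y then 0 else ket Y.
Proof.
rewrite -mulmxA cre_ket; case xY: (x \in Y); first by rewrite mulmx0.
rewrite -scalemxAr ann_ket setU11 setU1K ?xY //.
by rewrite (fsignD1 x (setU11 x Y)) ltnn mul1r setU1K ?xY // scalerA fsign_sq scale1r.
Qed.

Definition ketbra X Y : fock_op R L := ket X *m (ket Y)^t*.

Lemma ketbra_ket X Y Z : ketbra X Y *m ket Z = if Y == Z then ket X else 0.
Proof.
rewrite -mulmxA; have -> : (ket Y)^t* *m ket Z = (Y == Z)%:R%:M.
  apply/matrixP => i j; rewrite !ord1 -colE !mxE eqxx andbT mulr1n eq_sym.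
  by rewrite (inj_eq enum_rank_inj) conjC_nat.
by rewrite mul_mx_scalar; case: eqP; rewrite ?scale1r ?scale0r.
Qed.

Lemma car_ketbra00 : car_algebra (ketbra set0 set0).
Proof.
have H (s : seq L) : exists2 A, car_algebra A &
    forall Y, A *m ket Y = if has (mem Y) s then 0 else ket Y.
  elim: s => [|x s [A cA AE]].
    by exists 1%:M => [|Y]; [exact: CarOne | rewrite mul1mx].
  exists (A *m (ann x *m cre x)) => [|Y].
    by apply: CarMul cA _; apply: CarMul; [exact: CarAnn | exact: CarCre].
  by rewrite -mulmxA ann_cre_ket /=; case: (x \in Y); rewrite ?mulmx0 ?AE.
have [A cA AE] := H (enum L).
suff -> : ketbra set0 set0 = A by [].
apply: eq_on_kets => Y; rewrite AE ketbra_ket eq_sym.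
case: eqP => [->|Y0].
  by rewrite (_ : has _ _ = false) //; apply/hasPn => x _ /=; rewrite inE.
have /set0Pn[x xY] : Y != set0 by apply/eqP.
by rewrite (_ : has _ _ = true) //; apply/hasP; exists x; rewrite ?mem_enum.
Qed.

Lemma car_ketbra X Y : car_algebra (ketbra X Y).
Proof.
have S x (Z : {set L}) : x \in Z -> cre x *m ket (Z :\ x) = fsign x Z *: ket Z.
  by move=> xZ; rewrite cre_ket !inE eqxx /= setD1K // (fsignD1 x xZ) ltnn mul1r.
have S' x (Z : {set L}) : x \in Z -> ket Z = fsign x Z *: (cre x *m ket (Z :\ x)).
  by move=> /S ->; rewrite scalerA fsign_sq scale1r.
have [n] := ubnP (#|X| + #|Y|)%N; elim: n X Y => // n IH X Y.
have [-> | /set0Pn[x xX]] := eqVneq X set0.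
  have [-> | /set0Pn[y yY]] := eqVneq Y set0; first by move=> _; exact: car_ketbra00.
  rewrite (cardsD1 y Y) yY cards0 => lt.
  rewrite /ketbra (S' y Y yY) linearZ /= map_mxZ trmx_mul map_mxM -scalemxAr mulmxA.
  rewrite /cre trmxCK; apply/CarScale/CarMul/CarAnn.
  by apply: IH; rewrite cards0.
rewrite (cardsD1 x X) xX => lt.
rewrite /ketbra (S' x X xX) -scalemxAl -mulmxA.
by apply/CarScale/CarMul; [exact: CarCre | exact: IH].
Qed.

Lemma car_algebra_full A : car_algebra A.
Proof.
have -> : A = \sum_i \sum_j A i j *: ketbra (enum_val i) (enum_val j).
  rewrite {1}(matrix_sum_delta A); apply: eq_bigr => i _; apply: eq_bigr => j _.
  congr (_ *: _); rewrite /ketbra /ket !enum_valK trmx_delta.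
  by rewrite map_delta_mx mul_delta_mx.
elim/big_ind: _ => [||i _]; [exact: car_algebra0 | exact: CarAdd |].
elim/big_ind: _ => [||j _]; [exact: car_algebra0 | exact: CarAdd |].
exact/CarScale/car_ketbra.
Qed.

End CAR.

(* Main.v *)
Require Import Defs.
From HB Require Import structures.
From mathcomp Require Import all_boot all_order all_algebra.
From mathcomp Require Import complex reals.
From mathcomp Require Import ring lra.

Set Implicit Arguments.
Unset Strict Implicit.
Unset Printing Implicit Defensive.
Import Order.TTheory GRing.Theory Num.Theory.
Local Open Scope ring_scope.
Local Open Scope sesquilinear_scope.

(** The kernels decrease, so the layers E_n are mutually orthogonal projections
    with sum 1 - G_N over n < N.  Split
      |E_n psi|^2 = <(1 - g_(n+1)) psi, E_n psi> + <psi, g_(n+1) E_n psi>;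
    by (ii) the psi of the second term can be replaced by the sum of the E_k psi
    with n - l <= k <= n, and |g_(n+1) E_n psi| <= epsilon |E_n psi| by (iii).
    With s = epsilon sqrt(l + 1), apply Young's inequality to both terms, with
    weights 1 / (1 - s) and epsilon^2 / s chosen so that the |E_n psi|^2 on the
    right add up to half of the left side.  Summing over n counts each E_k at
    most l + 1 times, which gives
      (1 - s)^2 |psi|^2 <= sum_n <psi, (1 - g_(n+1)) psi>,
    and (i) telescopes the right side to <psi, H_N psi> / gamma. *)

(** * The real inner product underlying the complex one *)

Section RealInner.
Variables (R : realType) (d : nat).
Implicit Types (u v w : 'cV[R[i]]_d) (A B P Q : 'M[R[i]]_d).

(** Working in the ordered field [R] makes Young's inequality and linear arithmetic available.
    Nothing is lost at the end, since [inner u u] is real ([innerE]). *)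
Definition rinner u v : R := complex.Re (inner u v).

Lemma innerDr u v w : inner u (v + w) = inner u v + inner u w.
Proof. by rewrite /inner mulmxDr mxE. Qed.

Lemma innerZr c u v : inner u (c *: v) = c * inner u v.
Proof. by rewrite /inner -scalemxAr mxE. Qed.

Lemma inner_conj u v : inner u v = (inner v u)^*.
Proof.
rewrite /inner !mxE rmorph_sum; apply: eq_bigr => i _.
by rewrite !mxE rmorphM /= conjCK mulrC.
Qed.

Lemma inner_ge0 u : 0 <= inner u u.
Proof.
rewrite /inner !mxE; apply: sumr_ge0 => i _.
by rewrite !mxE mulrC mul_conjC_ge0.
Qed.

Lemma inner_adj A u v : inner u (A *m v) = inner (A^t* *m u) v.
Proof.
by rewrite /inner trmx_mul map_mxM /= trmxCK mulmxA.
Qed.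

Lemma inner_eq0 u : (inner u u == 0) = (u == 0).
Proof.
apply/eqP/eqP => [|->]; last by rewrite /inner mulmx0 mxE.
rewrite /inner !mxE => /eqP; rewrite psumr_eq0 => [/allP h|i _]; last first.
  by rewrite !mxE mulrC mul_conjC_ge0.
apply/matrixP => i j; rewrite ord1 !mxE.
have := h i; rewrite mem_index_enum => /(_ isT).
by rewrite !mxE mulrC mul_conjC_eq0 => /eqP.
Qed.

Lemma rinnerC u v : rinner u v = rinner v u.
Proof. by rewrite /rinner inner_conj; case: (inner v u). Qed.

Lemma rinnerDr u v w : rinner u (v + w) = rinner u v + rinner u w.
Proof. by rewrite /rinner innerDr raddfD. Qed.

Lemma rinnerZr (c : R) u v : rinner u (c%:C%C *: v) = c * rinner u v.
Proof. by rewrite /rinner innerZr; case: (inner u v) => a b /=; ring. Qed.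

Lemma rinnerBr u v w : rinner u (v - w) = rinner u v - rinner u w.
Proof. by rewrite -scaleN1r -(rmorphN1 (real_complex R)) rinnerDr rinnerZr mulN1r. Qed.

Lemma rinner0r u : rinner u 0 = 0.
Proof. by rewrite -(subrr 0) rinnerBr subrr. Qed.

Lemma rinnerBl u v w : rinner (u - v) w = rinner u w - rinner v w.
Proof. by rewrite !(rinnerC _ w) rinnerBr. Qed.

Lemma rinnerZl (c : R) u v : rinner (c%:C%C *: u) v = c * rinner u v.
Proof. by rewrite !(rinnerC _ v) rinnerZr. Qed.

Lemma rinner_sumr (I : finType) (D : pred I) u (F : I -> 'cV[R[i]]_d) :
  rinner u (\sum_(i | D i) F i) = \sum_(i | D i) rinner u (F i).
Proof. exact: (big_morph _ (rinnerDr u) (rinner0r u)). Qed.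

Lemma rinner_suml (I : finType) (D : pred I) u (F : I -> 'cV[R[i]]_d) :
  rinner (\sum_(i | D i) F i) u = \sum_(i | D i) rinner (F i) u.
Proof. by rewrite rinnerC rinner_sumr; apply: eq_bigr => i _; rewrite rinnerC. Qed.

Lemma rinner_ge0 u : 0 <= rinner u u.
Proof. by have := inner_ge0 u; rewrite lecE => /andP[]. Qed.

Lemma innerE u : inner u u = (rinner u u)%:C%C.
Proof.
have := inner_ge0 u; rewrite lecE /rinner => /andP[/eqP /= h _].
by case: (inner u u) h => a b /= ->.
Qed.

Lemma rinner_eq0 u : (rinner u u == 0) = (u == 0).
Proof. by rewrite -inner_eq0 innerE -(inj_eq (@complexI R)). Qed.

Lemma rinner_herm A u v : A \is hermsymmx -> rinner u (A *m v) = rinner (A *m u) v.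
Proof. by move=> /hermsymP Ah; rewrite /rinner inner_adj Ah. Qed.

Lemma le_op_rinner A B u : le_op A B -> rinner u (A *m u) <= rinner u (B *m u).
Proof. by move=> /(_ u); rewrite lecE => /andP[]. Qed.

(** Expand |t u - v|^2 >= 0 and divide by t. *)
Lemma rinner_young (t : R) u v : 0 < t ->
  2 * rinner u v <= t * rinner u u + t^-1 * rinner v v.
Proof.
move=> t0; have := rinner_ge0 (t%:C%C *: u - v).
rewrite rinnerBl !rinnerBr !rinnerZl !rinnerZr (rinnerC v u).
move: (rinner u u) (rinner u v) (rinner v v) => a b c h.
have := mulr_ge0 (ltW (_ : 0 < t^-1)) h; rewrite invr_gt0 => /(_ t0).
have -> : t^-1 * (t * (t * a) - t * b - (t * b - c)) = t * a - 2 * b + t^-1 * c.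
  by field; rewrite gt_eqF.
lra.
Qed.

(** * Kernels of non-negative operators and their projections *)

Lemma nonneg_ker A u : A \is hermsymmx -> le_op 0 A ->
  rinner u (A *m u) = 0 -> A *m u = 0.
Proof.
move=> Ah A0 u0; pose v := A *m u; apply/eqP; rewrite -rinner_eq0 -/v.
have pos w : 0 <= rinner w (A *m w).
  by have := le_op_rinner w A0; rewrite mul0mx rinner0r.
set q := rinner v v; have r0 := pos v; set r := rinner v (A *m v) in r0.
(* The quadratic form of A at (r + 1) u - q v is - (r + 2) q^2. *)
have := pos ((r + 1)%:C%C *: u - q%:C%C *: v).
rewrite mulmxBr -!scalemxAr rinnerBl !rinnerBr !rinnerZl !rinnerZr u0.
rewrite (rinner_herm u v Ah) -/v -/q -/r; move: (q) (r) r0 => {}q {}r r0 h.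
apply/negPn/negP => q0; have qq : 0 < q * q by rewrite -expr2 exprn_even_gt0.
have := mulr_ge0 r0 (ltW qq); lra.
Qed.

Lemma ker_proj_herm A P : is_ker_proj A P -> P \is hermsymmx.
Proof. by case. Qed.

Lemma ker_proj_mul0 A P : is_ker_proj A P -> A *m P = 0.
Proof.
case=> _ PP PA; apply: mx_eq_on_vectors => v.
by rewrite -mulmxA mul0mx; apply/PA; rewrite mulmxA PP.
Qed.

(** For w in ker B, 0 <= <w, A w> <= <w, B w> = 0, so [nonneg_ker] puts w in ker A. The inclusion of
    kernels is expressed as a product of projections. *)
Lemma ker_proj_antimono A B P Q : A \is hermsymmx -> le_op 0 A -> le_op A B ->
  is_ker_proj A P -> is_ker_proj B Q -> P *m Q = Q.
Proof.
move=> Ah A0 AB [_ _ PA] Qp; apply: mx_eq_on_vectors => v.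
rewrite -mulmxA; apply/PA/(nonneg_ker Ah A0)/le_anti/andP; split.
  have := le_op_rinner (Q *m v) AB.
  by rewrite [B *m (Q *m v)]mulmxA (ker_proj_mul0 Qp) mul0mx rinner0r.
by have := le_op_rinner (Q *m v) A0; rewrite mul0mx rinner0r.
Qed.

Lemma mulmx_herm_comm A B C : A \is hermsymmx -> B \is hermsymmx ->
  C \is hermsymmx -> A *m B = C -> B *m A = C.
Proof.
move=> /hermsymP Ah /hermsymP Bh /hermsymP Ch AB.
by rewrite -Ch -AB trmx_mul map_mxM /= Ah Bh.
Qed.

Lemma hermsymB A B : A \is hermsymmx -> B \is hermsymmx -> A - B \is hermsymmx.
Proof.
move=> /hermsymP Ah /hermsymP Bh; apply/hermsymP.
by rewrite linearB /= map_mxB Ah Bh.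
Qed.

Lemma hermsym1 : (1%:M : 'M[R[i]]_d) \is hermsymmx.
Proof. by apply/hermsymP; rewrite trmx1 map_mx1. Qed.

Lemma rinner_proj P u : P \is hermsymmx -> P *m P = P ->
  rinner (P *m u) (P *m u) = rinner u (P *m u).
Proof. by move=> Ph PP; rewrite -(rinner_herm u _ Ph) mulmxA PP. Qed.

(** * The martingale estimate for mutually orthogonal layers *)

Section Martingale.
(** Indices are shifted: [g n] stands for g_(n+1), paired with the layer E_n. *)
Variables (N l : nat) (E g : nat -> 'M[R[i]]_d) (epsilon s : R).
Hypotheses (Eh : forall n, (n < N)%N -> E n \is hermsymmx)
  (EE : forall k n, (k < N)%N -> (n < N)%N ->
     E k *m E n = if k == n then E n else 0)
  (gh : forall n, (n < N)%N -> g n \is hermsymmx)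
  (gg : forall n, (n < N)%N -> g n *m g n = g n)
  (Eg : forall n k, (n < N)%N -> (k < N)%N ->
     ~~ ((n <= k + l)%N && (k <= n)%N) -> E k *m g n = g n *m E k)
  (EgE : forall n, (n < N)%N ->
     le_op (E n *m g n *m E n) ((epsilon ^+ 2)%:C%C *: E n))
  (s_gt0 : 0 < s) (s_lt1 : s < 1) (s2 : s * s = epsilon ^+ 2 * l.+1%:R).

(** Only k < N occur: the remaining layer E_N = G_N annihilates the vector psi of interest. *)
Let window n (k : 'I_N) := (n <= k + l)%N && (k <= n)%N.

(** Outside the window E_k passes through [g n] and meets E_n, where the product vanishes because k
    = n always lies in the window. *)
Lemma window_inner psi n : psi = \sum_(k < N) E k *m psi -> (n < N)%N ->
  rinner psi (g n *m (E n *m psi)) =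
  rinner (\sum_(k < N | window n k) E k *m psi) (g n *m (E n *m psi)).
Proof.
move=> psiE nN; transitivity (rinner (\sum_(k < N) E k *m psi) (g n *m (E n *m psi))).
  by rewrite -psiE.
rewrite rinner_suml (bigID (window n)) /=.
rewrite [X in _ + X]big1 ?addr0 ?rinner_suml // => k out.
have kn : (k == n :> nat) = false.
  by apply: contraNF out => /eqP kn; rewrite /window kn leq_addr leqnn.
rewrite -(rinner_herm psi _ (Eh (ltn_ord k))) mulmxA Eg // -mulmxA.
by rewrite [E k *m (_ *m _)]mulmxA EE // kn mul0mx mulmx0 rinner0r.
Qed.

Lemma window_norm psi n :
  rinner (\sum_(k < N | window n k) E k *m psi)
         (\sum_(k < N | window n k) E k *m psi) =
  \sum_(k < N | window n k) rinner psi (E k *m psi).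
Proof.
rewrite rinner_suml; apply: eq_bigr => k wk; rewrite rinner_sumr (bigD1 k) //=.
rewrite rinner_proj ?Eh ?EE ?eqxx // big1 ?addr0 // => j /andP[_ jk].
rewrite -(rinner_herm psi _ (Eh (ltn_ord k))) mulmxA EE //.
by rewrite (inj_eq val_inj) eq_sym (negbTE jk) mul0mx rinner0r.
Qed.

(** The two Young inequalities bound 2 |E_n psi|^2 by the right side plus (1 - s) |E_n psi|^2 + s
    |E_n psi|^2, and the last two terms add up to one |E_n psi|^2. *)
Lemma layer_bound psi n : psi = \sum_(k < N) E k *m psi -> (n < N)%N ->
  rinner psi (E n *m psi) <=
  (1 - s)^-1 * rinner psi ((1%:M - g n) *m psi) +
  epsilon ^+ 2 * s^-1 * \sum_(k < N | window n k) rinner psi (E k *m psi).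
Proof.
move=> psiE nN.
have En := rinner_proj psi (Eh nN); rewrite EE // eqxx in En.
have Qh : 1%:M - g n \is hermsymmx := hermsymB hermsym1 (gh nN).
have QQ : (1%:M - g n) *m (1%:M - g n) = 1%:M - g n.
  by rewrite mulmxBr mulmx1 mulmxBl mul1mx gg // subrr subr0.
have split : rinner psi (E n *m psi) =
    rinner ((1%:M - g n) *m psi) (E n *m psi) +
    rinner psi (g n *m (E n *m psi)).
  by rewrite -(rinner_herm _ _ Qh) -rinnerDr mulmxBl mul1mx subrK.
have gE : rinner (g n *m (E n *m psi)) (g n *m (E n *m psi)) <=
    epsilon ^+ 2 * rinner psi (E n *m psi).
  (* The left side is <psi, E_n g E_n psi>, which [EgE] controls. *)
  rewrite rinner_proj ?gh ?gg // -(rinner_herm _ _ (Eh nN)) !mulmxA.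
  by have := le_op_rinner psi (EgE nN); rewrite -scalemxAl rinnerZr.
have s1 : 0 < 1 - s by rewrite subr_gt0.
have e0 : 0 < epsilon ^+ 2.
  (* If epsilon^2 were 0, then s * s would be 0 by [s2]. *)
  by rewrite lt0r sqr_ge0 andbT; apply: contraTneq (mulr_gt0 s_gt0 s_gt0) => e0;
     rewrite s2 e0 mul0r ltxx.
have Y1 := rinner_young ((1%:M - g n) *m psi) (E n *m psi) (_ : 0 < (1 - s)^-1).
rewrite invr_gt0 invrK rinner_proj // En // in Y1; have {}Y1 := Y1 s1.
have Y2 := rinner_young (\sum_(k < N | window n k) E k *m psi)
  (g n *m (E n *m psi)) (divr_gt0 e0 s_gt0).
rewrite window_norm -window_inner // invf_div in Y2.
have Y3 : s / epsilon ^+ 2 * rinner (g n *m (E n *m psi)) (g n *m (E n *m psi))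
    <= s * rinner psi (E n *m psi).
  apply: le_trans (ler_wpM2l _ gE) _; first by rewrite divr_ge0 ?ltW.
  by rewrite mulrA divfK ?gt_eqF.
(* Once the inner products are abstracted, the inequality is linear in the named terms and the
   product [s * a]. *)
move: En Y1 Y2 Y3 split; clear.
set a := rinner psi (E n *m psi); set b := (1 - s)^-1 * _.
set c := _ / s * _; set e := s / _ * _.
set x := rinner ((1%:M - g n) *m psi) _.
set y := rinner psi (g n *m _).
move: (a) (b) (c) (e) (x) (y) => {}a {}b {}c {}e {}x {}y.
lra.
Qed.

(** After exchanging the sums, [F k] is counted once for each n < N in [k, k + l], hence at most l +
    1 times. *)
Lemma window_sum (F : nat -> R) : (forall k, (k < N)%N -> 0 <= F k) ->
  \sum_(n < N) \sum_(k < N | window n k) F k <= l.+1%:R * \sum_(k < N) F k.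
Proof.
move=> F0; rewrite (exchange_big_dep xpredT) //= mulr_sumr; apply: ler_sum => k _.
rewrite sumr_const -[leLHS]mulr_natl ler_wpM2r ?F0 // ler_nat -sum1_card.
rewrite -(big_mkord (fun n => (n <= k + l)%N && (k <= n)%N) (fun=> 1%N)).
rewrite sum1_count -size_filter -(size_iota k l.+1).
apply: uniq_leq_size => [|n]; first by rewrite filter_uniq ?iota_uniq.
by rewrite mem_filter mem_iota => /andP[/andP[nl kn] _]; rewrite kn addnS ltnS.
Qed.

(** Of the two factors 1 - s, one is the Young weight and the other comes from absorbing s |psi|^2
    into the left side. *)
Lemma martingale_bound psi : psi = \sum_(k < N) E k *m psi ->
  (1 - s) ^+ 2 * rinner psi psi <=
  \sum_(n < N) rinner psi ((1%:M - g n) *m psi).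
Proof.
move=> psiE; set B := (X in _ <= X).
have psi2 : rinner psi psi = \sum_(n < N) rinner psi (E n *m psi).
  by rewrite -rinner_sumr -psiE.
have F0 k : (k < N)%N -> 0 <= rinner psi (E k *m psi).
  by move=> kN; rewrite -rinner_proj ?Eh ?EE ?eqxx // rinner_ge0.
have s1 : 0 < 1 - s by rewrite subr_gt0.
have : rinner psi psi <= (1 - s)^-1 * B + s * rinner psi psi.
  rewrite {1}psi2; apply: le_trans (ler_sum _ _) _.
    by move=> n _; apply: layer_bound (ltn_ord n).
  rewrite big_split /= -!mulr_sumr lerD2l.
  apply: le_trans (ler_wpM2l _ (window_sum F0)) _.
    by rewrite mulr_ge0 ?sqr_ge0 // invr_ge0 ltW.
  (* By [s2], the coefficient epsilon^2 (l + 1) / s is exactly s. *)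
  by rewrite -psi2 mulrA [_ * s^-1 * _]mulrAC -s2 mulfK ?gt_eqF.
set a := rinner psi psi => h.
have : (1 - s) * a <= (1 - s)^-1 * B by rewrite mulrBl mul1r lerBlDr.
by move/(ler_wpM2l (ltW s1)); rewrite mulrA -expr2 mulrA divff ?mul1r ?gt_eqF.
Qed.

End Martingale.

(** * The gap estimate in dimension d, from the decreasing kernels *)

Lemma martingale_gap (N : nat)
    (H G g : nat -> 'M[R[i]]_d) (gamma epsilon : R) (l : nat)
    (E := layer N G) (h := increment H)
    (H_0 : H 0%N = 0)
    (H_sa : forall n : nat, (n <= N)%N -> H n \is hermsymmx)
    (H_nonneg : forall n : nat, (n <= N)%N -> le_op 0 (H n))
    (H_incr : forall n : nat, (n < N)%N -> le_op (H n) (H n.+1))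
    (G_proj : forall n : nat, (n <= N)%N -> is_ker_proj (H n) (G n))
    (g_proj : forall n : nat, (1 <= n <= N)%N -> is_ker_proj (h n) (g n))
    (gamma_gt0 : 0 < gamma)
    (hyp_i : forall n : nat, (1 <= n <= N)%N ->
       le_op (gamma%:C%C *: (1%:M - g n)) (h n))
    (hyp_ii : forall n k : nat, (n < N)%N -> (k <= N)%N ->
       ~~ ((n <= k + l)%N && (k <= n)%N) -> comm_op (E k) (g n.+1) = 0)
    (epsilon_gt0 : 0 < epsilon)
    (epsilon_lt : epsilon < 1 / Num.sqrt (l%:R + 1))
    (hyp_iii : forall n : nat, (n < N)%N ->
       le_op (E n *m g n.+1 *m E n) ((epsilon ^+ 2)%:C%C *: E n))
    (psi : 'cV[R[i]]_d) (psi_ker : G N *m psi = 0) :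
  (gamma * (1 - epsilon * Num.sqrt (1 + l%:R)) ^+ 2)%:C%C * inner psi psi
    <= inner psi (H N *m psi).
Proof.
have G_herm n : (n <= N)%N -> G n \is hermsymmx.
  by move=> nN; apply: ker_proj_herm (G_proj n nN).
(* With G_0 = 1, the bottom layer 1 - G_1 also has the form G_n - G_(n+1). *)
have G0 : G 0%N = 1%:M.
  have [_ _ G0P] := G_proj 0%N (leq0n N); apply: mx_eq_on_vectors => v.
  by rewrite mul1mx; apply/G0P; rewrite H_0 mul0mx.
have GG m n : (m <= n)%N -> (n <= N)%N -> G m *m G n = G n.
  elim: n => [|n IH].
    by rewrite leqn0 => /eqP -> _; rewrite G0 mulmx1.
  rewrite leq_eqVlt => /predU1P[-> nN|mn nN].
    by case: (G_proj _ nN).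
  have step : G n *m G n.+1 = G n.+1 :=
    ker_proj_antimono (H_sa n (ltnW nN)) (H_nonneg n (ltnW nN)) (H_incr n nN)
      (G_proj n (ltnW nN)) (G_proj n.+1 nN).
  by rewrite -[in LHS]step mulmxA (IH mn (ltnW nN)) step.
have GG' m n : (m <= n)%N -> (n <= N)%N -> G n *m G m = G n.
  move=> mn nN; apply: mulmx_herm_comm (GG m n mn nN); apply: G_herm => //.
  exact: leq_trans mn nN.
have EE n : (n < N)%N -> E n = G n - G n.+1.
  by move=> nN; rewrite /E /layer (ltn_eqF nN); case: n nN => //= _; rewrite G0.
have E_herm n : (n < N)%N -> E n \is hermsymmx.
  by move=> nN; rewrite EE //; apply: hermsymB; apply: G_herm => //; apply: ltnW.
have E_mul k n : (k < N)%N -> (n < N)%N ->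
    E k *m E n = if k == n then E n else 0.
  move=> kN nN; rewrite !EE // mulmxBl !mulmxBr.
  (* Each of the four products equals the G of larger index, so they cancel unless k = n. *)
  case: ltngtP => [kn|nk|<-].
  - have kn' := ltnW kn; have nN' := ltnW nN.
    by rewrite (GG k n) // (GG k n.+1) ?leqW //
      (GG k.+1 n) // (GG k.+1 n.+1) ?leqW // subrr.
  - have nk' := ltnW nk; have kN' := ltnW kN.
    by rewrite (GG' n k) // (GG' n.+1 k) //
      (GG' n k.+1) ?leqW // (GG' n.+1 k.+1) ?leqW // !subrr.
  - have kN' := ltnW kN.
    by rewrite (GG k k) // (GG k k.+1) // (GG' k k.+1) // (GG k.+1 k.+1) // subrr subr0.
(* The layers telescope to G_0 - G_N = 1 - G_N, and G_N psi = 0. *)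
have psiE : psi = \sum_(k < N) E k *m psi.
  rewrite -mulmx_suml (eq_bigr (fun k : 'I_N => G k - G k.+1)) => [|k _]; last exact: EE.
  rewrite -(big_mkord xpredT (fun k => G k - G k.+1)).
  rewrite -[X in X *m _]opprK -sumrN (eq_bigr _ (fun k _ => opprB _ _)).
  by rewrite telescope_sumr // opprB G0 mulmxBl mul1mx psi_ker subr0.
have l0 : (0 : R) < 1 + l%:R by rewrite ltr_pwDl ?ler0n ?ltr01.
have sl : 0 < Num.sqrt (1 + l%:R : R) by rewrite sqrtr_gt0.
set s := epsilon * Num.sqrt (1 + l%:R).
have s_gt0 : 0 < s by rewrite mulr_gt0.
have s_lt1 : s < 1 by rewrite -ltr_pdivlMr // [1 + _]addrC.
have s2 : s * s = epsilon ^+ 2 * l.+1%:R.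
  by rewrite mulrACA -!expr2 sqr_sqrtr ?ltW // -natr1 addrC.
have bound : (1 - s) ^+ 2 * rinner psi psi <=
    \sum_(n < N) rinner psi ((1%:M - g n.+1) *m psi).
  apply: (martingale_bound E_herm E_mul _ _ _ hyp_iii s_gt0 s_lt1 s2 psiE).
  - by move=> n nN; apply: ker_proj_herm (g_proj n.+1 _).
  - by move=> n nN; case: (g_proj n.+1 nN).
  - by move=> n k nN kN out; apply/subr0_eq/hyp_ii => //; apply: ltnW.
have HE : \sum_(n < N) rinner psi (h n.+1 *m psi) = rinner psi (H N *m psi).
  rewrite -rinner_sumr -mulmx_suml -(big_mkord xpredT (fun n => h n.+1)).
  by rewrite telescope_sumr // H_0 subr0.
(* The order on [R[i]] requires equal imaginary parts; comparison with 0 in [H_nonneg] supplies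
   this. *)
have im0 : complex.Im (inner psi (H N *m psi)) = 0.
  have := H_nonneg N (leqnn N) psi; rewrite mul0mx -(scale0r 0) innerZr mul0r.
  by rewrite lecE => /andP[/eqP].
rewrite innerE -rmorphM lecE /= im0 eqxx /= -mulrA.
rewrite -/(rinner psi (H N *m psi)) -HE.
apply: le_trans (ler_wpM2l (ltW gamma_gt0) bound) _.
(* With gamma moved inside the sum, hypothesis (i) applies term by term. *)
rewrite mulr_sumr; apply: ler_sum => n _.
have := le_op_rinner psi (hyp_i n.+1 (ltn_ord n)).
by rewrite -scalemxAl rinnerZr.
Qed.

End RealInner.

(** * The gap estimate on the fermionic Fock space *)

Theorem theorem5p1 (R : realType) (L : finType) (N : nat)
    (H G g : nat -> fock_op R L) (gamma epsilon : R) (l : nat)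
    (E := layer N G) (h := increment H)
    (H_0 : H 0%N = 0)
    (H_even : forall n : nat, (n <= N)%N -> even_op (H n))
    (H_sa : forall n : nat, (n <= N)%N -> H n \is hermsymmx)
    (H_nonneg : forall n : nat, (n <= N)%N -> le_op 0 (H n))
    (H_incr : forall n : nat, (n < N)%N -> le_op (H n) (H n.+1))
    (H_ker : forall n : nat, (n <= N)%N -> nontrivial_ker (H n))
    (G_proj : forall n : nat, (n <= N)%N -> is_ker_proj (H n) (G n))
    (g_proj : forall n : nat, (1 <= n <= N)%N -> is_ker_proj (h n) (g n))
    (gamma_gt0 : 0 < gamma)
    (hyp_i : forall n : nat, (1 <= n <= N)%N ->
       le_op (gamma%:C%C *: (1%:M - g n)) (h n))
    (hyp_ii : forall n k : nat, (n < N)%N -> (k <= N)%N ->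
       ~~ ((n <= k + l)%N && (k <= n)%N) -> comm_op (E k) (g n.+1) = 0)
    (epsilon_gt0 : 0 < epsilon)
    (epsilon_lt : epsilon < 1 / Num.sqrt (l%:R + 1))
    (hyp_iii : forall n : nat, (n < N)%N ->
       le_op (E n *m g n.+1 *m E n) ((epsilon ^+ 2)%:C%C *: E n))
    (psi : fock R L) (psi_ker : G N *m psi = 0) :
  (gamma * (1 - epsilon * Num.sqrt (1 + l%:R)) ^+ 2)%:C%C * inner psi psi
    <= inner psi (H N *m psi).
Proof.
exact: (martingale_gap H_0 H_sa H_nonneg H_incr G_proj g_proj gamma_gt0 hyp_i hyp_ii
  epsilon_gt0 epsilon_lt hyp_iii psi_ker).
Qed.
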